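(* Let $m,n\geq 2$ be integers and let $\mathcal{C}_{m,n}=\operatorname{SPC}(m)\otimes\operatorname{SPC}(n)$. For $0\leq r\leq m$ and $0\leq t\leq n$ put $$Z(r,t)=rt+(m-r)(n-t),\qquad O(r,t)=r(n-t)+(m-r)t.$$ Then the homogeneous weight enumerator of $\mathcal{C}_{m,n}$ is $$W_{\mathcal{C}_{m,n}}(x,y)=\frac{1}{2^{m+n}}\sum_{r=0}^{m}\binom{m}{r}\sum_{t=0}^{n}\binom{n}{t}(x+y)^{Z(r,t)}(x-y)^{O(r,t)}.$$ Equivalently, its one-variable weight enumerator is $$W_{\mathcal{C}_{m,n}}(z)=\frac{1}{2^{m+n}}\sum_{r=0}^{m}\binom{m}{r}\sum_{t=0}^{n}\binom{n}{t}(1+z)^{Z(r,t)}(1-z)^{O(r,t)}.$$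
   Context: For $\ell\geq 2$, $\operatorname{SPC}(\ell)=\{\mathbf{x}\in\mathbb{F}_2^\ell:\sum_{i=1}^{\ell}x_i=0\}$ is the binary single parity-check code of length $\ell$. For binary linear codes $C_1,C_2$ with generator matrices $G_1,G_2$, the product code $C_1\otimes C_2$ is the linear code generated by the Kronecker product $G_1\otimes G_2$. Arranging coordinates row by row, $\mathcal{C}_{m,n}=\operatorname{SPC}(m)\otimes\operatorname{SPC}(n)$ is the $\mathbb{F}_2$-linear space of all $m\times n$ matrices over $\mathbb{F}_2$ in which every row and every column has even Hamming weight; its length is $mn$. For a linear code $\mathcal{C}$ of length $N$, let $A_w$ be the number of codewords of Hamming weight $w$ (number of nonzero entries). The homogeneous weight enumerator is $W_{\mathcal{C}}(x,y)=\sum_{w=0}^{N}A_w x^{N-w}y^w$, and the one-variable weight enumerator is $W_{\mathcal{C}}(z)=W_{\mathcal{C}}(1,z)=\sum_{w=0}^{N}A_w z^w$. *)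

(* Defs.v *)
From HB Require Import structures.
From mathcomp Require Import all_boot all_order all_algebra.
From mathcomp Require Import mxtens mpoly.

Set Implicit Arguments.
Unset Strict Implicit.
Unset Printing Implicit Defensive.

Import GRing.Theory.
Local Open Scope ring_scope.

(* A binary linear code of length N is a {vspace 'rV['F_2]_N}. *)

Section GeneratorMatrix.
Variables (k N : nat).

Definition code_of_mx (G : 'M['F_2]_(k, N)) : {vspace 'rV['F_2]_N} :=
  <<[seq row i G | i <- enum 'I_k]>>%VS.

Definition is_gen_mx (G : 'M['F_2]_(k, N)) (C : {vspace 'rV['F_2]_N}) : bool :=
  basis_of C [seq row i G | i <- enum 'I_k].

Lemma mem_code_of_mx (G : 'M['F_2]_(k, N)) v :
  (v \in code_of_mx G) = (v <= G)%MS.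
Proof.
apply/idP/idP.
  move=> /coord_span ->; apply: summx_sub => i _; apply: scalemx_sub.
  have lti : (i < size [seq row i G | i <- enum 'I_k])%N.
    by rewrite size_map -cardE.
  have /mapP[j _ ->] := mem_nth 0 lti.
  exact: row_sub.
case/submxP => A ->; rewrite mulmx_sum_row; apply: memv_suml => i _.
by apply: memvZ; apply: memv_span; apply/mapP; exists i; rewrite ?mem_enum.
Qed.

End GeneratorMatrix.

Definition gen_mx N (C : {vspace 'rV['F_2]_N}) : 'M['F_2]_(\dim C, N) :=
  \matrix_(i < \dim C) (vbasis C)`_i.

Lemma gen_mxP N (C : {vspace 'rV['F_2]_N}) : is_gen_mx (gen_mx C) C.
Proof.
rewrite /is_gen_mx.
suff -> : [seq row i (gen_mx C) | i <- enum 'I_(\dim C)] = vbasis C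
  by exact: vbasisP.
apply: (@eq_from_nth _ 0); rewrite size_map size_enum_ord ?size_tuple //.
move=> i lti; rewrite (nth_map (Ordinal lti)) ?size_enum_ord //.
by rewrite rowK nth_enum_ord.
Qed.

(* [*t] is the Kronecker product; the coordinate of index [i * N2 + j] is the
   entry [(i, j)] of an [N1 x N2] array. *)
Definition product_code N1 N2
    (C1 : {vspace 'rV['F_2]_N1}) (C2 : {vspace 'rV['F_2]_N2}) :
    {vspace 'rV['F_2]_(N1 * N2)} :=
  code_of_mx (gen_mx C1 *t gen_mx C2).

Lemma product_codeE N1 N2 k1 k2
    (C1 : {vspace 'rV['F_2]_N1}) (C2 : {vspace 'rV['F_2]_N2})
    (G1 : 'M['F_2]_(k1, N1)) (G2 : 'M['F_2]_(k2, N2)) :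
  is_gen_mx G1 C1 -> is_gen_mx G2 C2 ->
  product_code C1 C2 = code_of_mx (G1 *t G2).
Proof.
have sub k k' N (C : {vspace 'rV['F_2]_N}) (G : 'M_(k, N)) (G' : 'M_(k', N)) :
    is_gen_mx G C -> is_gen_mx G' C -> (G <= G')%MS.
  move=> /andP[/eqP gG _] /andP[/eqP gG' _]; apply/row_subP => i.
  by rewrite -mem_code_of_mx /code_of_mx gG' -gG -/(code_of_mx G)
     mem_code_of_mx row_sub.
have tens l1 l2 l1' l2' (A : 'M['F_2]_(l1, N1)) (B : 'M['F_2]_(l2, N2))
    (A' : 'M['F_2]_(l1', N1)) (B' : 'M['F_2]_(l2', N2)) :
    (A <= A')%MS -> (B <= B')%MS -> (A *t B <= A' *t B')%MS.
  by case/submxP => U -> /submxP[V ->]; rewrite -tensmx_mul submxMl.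
move=> g1 g2; apply/vspaceP => v; rewrite !mem_code_of_mx.
by apply/idP/idP => /submx_trans; apply; apply: tens;
  apply: sub; eauto using gen_mxP.
Qed.

Section SPC.
Variable l : nat.

Definition coord_sum (x : 'rV['F_2]_l) : 'F_2 := \sum_(i < l) x 0 i.

Fact coord_sum_is_linear : linear_for *%R coord_sum.
Proof.
move=> a x y; rewrite /coord_sum mulr_sumr -big_split /=.
by apply: eq_bigr => i _; rewrite !mxE.
Qed.

HB.instance Definition _ :=
  GRing.isLinear.Build 'F_2 'rV['F_2]_l 'F_2 _ coord_sum coord_sum_is_linear.

Definition SPC : {vspace 'rV['F_2]_l} :=
  lker (linfun (coord_sum : 'rV['F_2]_l -> ('F_2)^o)).

Lemma mem_SPC (x : 'rV['F_2]_l) : (x \in SPC) = (\sum_(i < l) x 0 i == 0).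
Proof. by rewrite memv_ker lfunE. Qed.

End SPC.

Section WeightEnumerator.
Variable N : nat.
Implicit Type C : {vspace 'rV['F_2]_N}.

Definition hweight (v : 'rV['F_2]_N) : nat := #|[set i | v 0 i != 0]|.

Definition weight_count C (w : nat) : nat :=
  #|[set c : 'rV['F_2]_N | (c \in C) && (hweight c == w)]|.

(* The enumerators live over [rat] because of the factor [1 / 2 ^ (m + n)];
   [x] is the variable ['X_0] and [y] the variable ['X_1]. *)
Definition hom_weight_enum C : {mpoly rat[2]} :=
  \sum_(w < N.+1) (weight_count C w)%:R *: ('X_0 ^+ (N - w) * 'X_1 ^+ w).

Definition weight_enum C : {poly rat} :=
  \sum_(w < N.+1) (weight_count C w)%:R *: 'X^w.

Lemma weight_enumE C :
  weight_enum C =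
  mmap (@polyC rat) (fun i : 'I_2 => if i == 0 then 1 else 'X)
    (hom_weight_enum C).
Proof.
rewrite /hom_weight_enum raddf_sum; apply: eq_bigr => w _ /=.
by rewrite mmapZ rmorphM !rmorphXn /= !mmapX !mmap1U /= expr1n mul1r mul_polyC.
Qed.

End WeightEnumerator.

Definition Zexp (m n r t : nat) : nat := (r * t + (m - r) * (n - t))%N.
Definition Oexp (m n r t : nat) : nat := (r * (n - t) + (m - r) * t)%N.

(* Main.v *)
Require Import Defs.
From mathcomp Require Import all_boot all_order all_algebra.
From mathcomp Require Import mxtens mpoly.

(** Write chi for the nontrivial character of F_2.  For the code of arrays with
    even rows and columns, 2^(m+n) times the indicator of a word v is the
    product over all row sums and column sums s of (1 + chi(s)).  Expanding it
    gives a sum over sets A of rows and B of columns; the sum over v then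
    factors over the entries, and the entry (i, j) contributes x + y if i \in A
    and j \in B are equivalent, and x - y otherwise.  The resulting product
    depends only on r = #|A| and t = #|B|. *)

Set Implicit Arguments.
Unset Strict Implicit.
Unset Printing Implicit Defensive.

Import GRing.Theory.
Local Open Scope ring_scope.

(** * Product codes as spaces of arrays *)

Lemma gen_mx_sub N (C : {vspace 'rV['F_2]_N}) (v : 'rV['F_2]_N) :
  (v <= gen_mx C)%MS = (v \in C).
Proof.
by rewrite -mem_code_of_mx /code_of_mx (span_basis (gen_mxP C)).
Qed.

Lemma big_mxtens (R : Type) (idx : R) (op : Monoid.com_law idx) m n
    (F : 'I_(m * n) -> R) :
  \big[op/idx]_i \big[op/idx]_j F (mxtens_index (i, j)) = \big[op/idx]_k F k.
Proof.
rewrite pair_big (reindex (@mxtens_unindex m n)) /=.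
  by apply: eq_bigr => k _; congr F; rewrite -[RHS]mxtens_unindexK.
by exists (@mxtens_index m n) => k _; rewrite ?mxtens_indexK ?mxtens_unindexK.
Qed.

Definition array m n (v : 'rV['F_2]_(m * n)) : 'M['F_2]_(m, n) :=
  \matrix_(i, j) v 0 (mxtens_index (i, j)).

(** On flattened arrays the Kronecker product acts by multiplication on both sides, which separates
    the condition on columns from the condition on rows. *)
Lemma array_mul_tensmx m n k1 k2 (G1 : 'M['F_2]_(k1, m)) (G2 : 'M_(k2, n))
    (u : 'rV_(k1 * k2)) :
  array (u *m (G1 *t G2)) = G1^T *m array u *m G2.
Proof.
apply/matrixP => i j; rewrite !mxE -big_mxtens exchange_big /=.
apply: eq_bigr => b _; rewrite mxE mulr_suml; apply: eq_bigr => a _.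
by rewrite tensmxE !mxE -mulrA mulrCA.
Qed.

Lemma array_inj m n : injective (@array m n).
Proof.
move=> u v /matrixP uv; apply/rowP => k; case: (mxtens_indexP k) => i j.
by have := uv i j; rewrite !mxE.
Qed.

Lemma array_surj m n (M : 'M['F_2]_(m, n)) : exists u, array u = M.
Proof.
exists (\row_k M (mxtens_unindex k).1 (mxtens_unindex k).2).
by apply/matrixP => i j; rewrite !mxE mxtens_indexK.
Qed.

Lemma mem_product_code m n (C1 : {vspace 'rV['F_2]_m})
    (C2 : {vspace 'rV['F_2]_n}) v :
  (v \in product_code C1 C2) =
  [forall i, row i (array v) \in C2] && [forall j, row j (array v)^T \in C1].
Proof.
rewrite mem_code_of_mx; apply/submxP/andP => [[u ->]|[/forallP vC2 /forallP vC1]].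
  rewrite array_mul_tensmx; split; apply/forallP => i; rewrite -gen_mx_sub.
    by rewrite row_mul submxMl.
  by rewrite -mulmxA trmx_mul trmxK row_mul submxMl.
have M2 : (array v <= gen_mx C2)%MS by apply/row_subP => i; rewrite gen_mx_sub.
have M1 : ((array v)^T <= gen_mx C1)%MS.
  by apply/row_subP => i; rewrite gen_mx_sub.
(* By [M1] and [M2], the pseudo-inverse followed by the generator matrix fixes [array v] on either
   side, so stripping both generators gives the message array. *)
have [u uE] :=
  array_surj (((array v)^T *m pinvmx (gen_mx C1))^T *m pinvmx (gen_mx C2)).
exists u; apply: array_inj; rewrite array_mul_tensmx uE mulmxA -trmx_mul.
by rewrite (mulmxKpV M1) trmxK mulmxKpV.
Qed.

Lemma mem_product_SPC m n v :
  (v \in product_code (SPC m) (SPC n)) =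
  [forall i, \sum_(j < n) v 0 (mxtens_index (i, j)) == 0] &&
  [forall j, \sum_(i < m) v 0 (mxtens_index (i, j)) == 0].
Proof.
rewrite mem_product_code; congr (_ && _); apply: eq_forallb => i;
  by rewrite mem_SPC; congr (_ == _); apply: eq_bigr => j _; rewrite !mxE.
Qed.

(** * Character sums over F_2 *)

Section CharacterSum.
Variable R : comNzRingType.
Implicit Types x y : R.

Definition chi (a : 'F_2) : R := if a == 0 then 1 else -1.

Lemma F2_cases (a : 'F_2) : a = 0 \/ a = 1.
Proof. by case: a => [[|[|a]] lta] //; [left|right]; apply: val_inj. Qed.

Lemma chiD : {morph chi : a b / a + b >-> a * b}.
Proof.
by move=> a b; case: (F2_cases a) => ->; case: (F2_cases b) => ->;
  rewrite /chi /= ?mul1r ?mulr1 ?mulrNN ?mulr1.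
Qed.

Lemma chi_sum (I : finType) (F : I -> 'F_2) :
  chi (\sum_i F i) = \prod_i chi (F i).
Proof. exact: (big_morph chi chiD). Qed.

Lemma add1_chi a : 1 + chi a = 2 * (a == 0)%:R.
Proof. by rewrite /chi; case: eqP => _; rewrite ?mulr1 ?mulr0 ?subrr. Qed.

(** Each factor is 2 or 0, so one nonzero [F i] kills the product. *)
Lemma prod_add1_chi (I : finType) (F : I -> 'F_2) :
  \prod_i (1 + chi (F i)) = 2 ^+ #|I| * [forall i, F i == 0]%:R.
Proof.
under eq_bigr do rewrite add1_chi.
rewrite big_split /= prodr_const; congr (_ * _).
case: forallP => [F0|F0]; first by rewrite big1 // => i _; rewrite F0.
apply/eqP; case: (pickP (fun i => F i != 0)) => [i Fi|F1].
  by rewrite (bigD1 i) //= (negPf Fi) mul0r.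
by case: F0 => i; apply: negbFE; rewrite F1.
Qed.

(** [A] records the indices where the character is picked from [1 + chi]. The test on [A] is pushed
    inside the product over [j] so that row and column expansions both become products over
    entries. *)
Lemma prod_add1_chi_sum (I J : finType) (F : I -> J -> 'F_2) :
  \prod_i (1 + chi (\sum_j F i j)) =
  \sum_(A : {set I}) \prod_i \prod_j (if i \in A then chi (F i j) else 1).
Proof.
under eq_bigr do rewrite addrC chi_sum.
rewrite bigA_distr /=; apply: eq_bigr => A _; apply: eq_bigr => i _.
by case: ifP => // _; rewrite big1.
Qed.

(** Distributivity, with a word seen as a choice of one letter per coordinate. *)
Lemma sum_rV_prod (T : finType) N (F : 'I_N -> T -> R) :
  \sum_(v : 'rV[T]_N) \prod_k F k (v 0 k) = \prod_k \sum_a F k a.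
Proof.
rewrite bigA_distr_bigA (reindex (fun f : {ffun 'I_N -> T} => \row_k f k)) /=.
  by apply: eq_bigr => f _; apply: eq_bigr => k _; rewrite mxE.
exists (fun v : 'rV[T]_N => [ffun k => v 0 k]) => f _.
  by apply/ffunP => k; rewrite ffunE mxE.
by apply/rowP => k; rewrite mxE ffunE.
Qed.

Lemma sum_F2 (F : 'F_2 -> R) : \sum_a F a = F 0 + F 1.
Proof. by rewrite big_ord_recl big_ord1; congr (_ + F _); apply: val_inj. Qed.

(** * Weights as products over coordinates, and counting by cardinality *)

Lemma hweight_monomial N (v : 'rV['F_2]_N) x y :
  x ^+ (N - hweight v) * y ^+ hweight v =
  \prod_k (if v 0 k == 0 then x else y).
Proof.
rewrite (bigID (fun k => v 0 k == 0)) /=; congr (_ * _).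
  rewrite (eq_bigr (fun=> x)) => [|k ->//]; rewrite prodr_const.
  congr (_ ^+ _); rewrite -[X in (X - _)%N](card_ord N) /hweight.
  rewrite -(cardC [pred k | v 0 k == 0]) cardsE.
  by rewrite (@eq_card _ [predC _] [pred k | v 0 k != 0]) ?addnK.
rewrite (eq_bigr (fun=> y)) => [|k /negPf->//]; rewrite prodr_const.
by rewrite /hweight cardsE.
Qed.

(** Grouping words by weight turns the enumerator into a sum over the whole ambient space, where the
    indicator of [C] can be expanded in characters. *)
Lemma sum_weight_count N (C : {vspace 'rV['F_2]_N}) x y :
  \sum_(w < N.+1) (weight_count C w)%:R * (x ^+ (N - w) * y ^+ w) =
  \sum_v (v \in C)%:R * \prod_k (if v 0 k == 0 then x else y).
Proof.
have hwN (v : 'rV['F_2]_N) : (hweight v < N.+1)%N.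
  by rewrite ltnS -[X in (_ <= X)%N]card_ord max_card.
rewrite (partition_big (fun v => Ordinal (hwN v)) xpredT) //=.
apply: eq_bigr => w _; rewrite /weight_count -sum1_card natr_sum.
rewrite mulr_suml big_mkcond [RHS]big_mkcond /=; apply: eq_bigr => v _.
rewrite inE -hweight_monomial -val_eqE /=.
by case: eqP => [->|_]; case: (v \in C); rewrite /= ?mul1r ?mul0r.
Qed.

(** The two memberships agree on A x B and on the product of the complements, which together have
    [Zexp] entries; the other [Oexp] entries form the two mixed blocks. *)
Lemma prod_eq_membership m n (A : {set 'I_m}) (B : {set 'I_n}) x y :
  \prod_i \prod_j (if (i \in A) == (j \in B) then x else y) =
  x ^+ Zexp m n #|A| #|B| * y ^+ Oexp m n #|A| #|B|.
Proof.
have prodB a : \prod_j (if a == (j \in B) then x else y) =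
    if a then x ^+ #|B| * y ^+ (n - #|B|) else x ^+ (n - #|B|) * y ^+ #|B|.
  have cB : (n - #|B|)%N = #|[predC B]|.
    by rewrite -[X in (X - _)%N](card_ord n) -(cardC B) addKn.
  rewrite cB (bigID (mem B)) /= (eq_bigr (fun=> if a then x else y)).
    rewrite (eq_bigr (fun=> if a then y else x) (P := fun i => i \notin B)).
      by rewrite !prodr_const; case: a => //; rewrite mulrC.
    by move=> j /negPf->; case: a.
  by move=> j ->; case: a.
have cA : (m - #|A|)%N = #|[predC A]|.
  by rewrite -[X in (X - _)%N](card_ord m) -(cardC A) addKn.
under eq_bigr do rewrite prodB.
rewrite (bigID (mem A)) /=.
rewrite (eq_bigr (fun=> x ^+ #|B| * y ^+ (n - #|B|))); last by move=> i ->.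
rewrite (eq_bigr (fun=> x ^+ (n - #|B|) * y ^+ #|B|) (P := fun i => i \notin A));
  last by move=> i /negPf->.
rewrite !prodr_const -cA /Zexp /Oexp !exprMn -!exprM !exprD.
rewrite ![((m - _) * _)%N]mulnC ![(#|A| * _)%N]mulnC.
by rewrite mulrACA.
Qed.

Lemma sum_set_card m (F : nat -> R) :
  \sum_(A : {set 'I_m}) F #|A| = \sum_(r < m.+1) 'C(m, r)%:R * F r.
Proof.
have cA (A : {set 'I_m}) : (#|A| < m.+1)%N.
  by rewrite ltnS -[X in (_ <= X)%N]card_ord max_card.
rewrite (partition_big (fun A => Ordinal (cA A)) xpredT) //=.
apply: eq_bigr => r _; rewrite (eq_bigr (fun=> F r)) => [|A /eqP<-//].
rewrite sumr_const mulr_natl -[X in 'C(X, _)](card_ord m) -card_draws cardsE.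
by congr (_ *+ _); apply: eq_card => A; rewrite !unfold_in -val_eqE.
Qed.

(** With the power of 2 kept on the left, the identity makes sense in any commutative ring. *)
Lemma product_SPC_character_sum m n x y :
  let C := product_code (SPC m) (SPC n) in
  2 ^+ (m + n) *
    \sum_(w < (m * n).+1) (weight_count C w)%:R * (x ^+ (m * n - w) * y ^+ w) =
  \sum_(r < m.+1) 'C(m, r)%:R *
    \sum_(t < n.+1) 'C(n, t)%:R *
      ((x + y) ^+ Zexp m n r t * (x - y) ^+ Oexp m n r t).
Proof.
move=> C; rewrite sum_weight_count mulr_sumr.
(* Factor of entry [k] once [A] and [B] are chosen: row sign, column sign, and weight variable. *)
pose g (A : {set 'I_m}) (B : {set 'I_n}) (k : 'I_(m * n)) (a : 'F_2) : R :=
  (if (mxtens_unindex k).1 \in A then chi a else 1) *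
  (if (mxtens_unindex k).2 \in B then chi a else 1) *
  (if a == 0 then x else y).
transitivity (\sum_(v : 'rV['F_2]_(m * n)) \sum_A \sum_B \prod_k g A B k (v 0 k)).
  apply: eq_bigr => v _; rewrite mem_product_SPC -mulnb natrM exprD.
  rewrite mulrA [2 ^+ m * _ * _]mulrACA -[X in 2 ^+ X * _ * _](card_ord m).
  rewrite -[X in _ * (2 ^+ X * _) * _](card_ord n) -!prod_add1_chi.
  rewrite !prod_add1_chi_sum mulr_suml mulr_suml; apply: eq_bigr => A _.
  rewrite mulr_sumr mulr_suml; apply: eq_bigr => B _.
  (* The column expansion lists entries column by column; after the exchange all three products run
     over entries in the same order and merge. *)
  rewrite [X in _ * X * _]exchange_big !big_split -!big_mxtens.
  by congr (_ * _ * _); apply: eq_bigr => i _; apply: eq_bigr => j _;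
    rewrite mxtens_indexK.
rewrite exchange_big /=.
pose S (r t : nat) := (x + y) ^+ Zexp m n r t * (x - y) ^+ Oexp m n r t.
under [RHS]eq_bigr do rewrite -(sum_set_card n (S _)).
rewrite -(sum_set_card m (fun r => \sum_(B : {set 'I_n}) S r #|B|)).
apply: eq_bigr => A _; rewrite exchange_big /=; apply: eq_bigr => B _.
rewrite sum_rV_prod -big_mxtens /S -prod_eq_membership.
apply: eq_bigr => i _; apply: eq_bigr => j _.
(* The letter 0 gives [x]. The letter 1 gives [y] with one sign for each membership that holds, and
   two signs cancel. *)
rewrite sum_F2 /g mxtens_indexK /= /chi eqxx /=.
by case: (i \in A); case: (j \in B); rewrite /= ?mulrNN !mul1r ?mulN1r.
Qed.

End CharacterSum.

(** Over a rational algebra the power of 2 can be divided out. Leaving [L], [x] and [y] free makes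
    both enumerators instances. *)
Lemma product_SPC_enumerator (L : comAlgType rat) m n (x y : L) :
  \sum_(w < (m * n).+1)
    (weight_count (product_code (SPC m) (SPC n)) w)%:R *:
      (x ^+ (m * n - w) * y ^+ w) =
  (2 ^+ (m + n))^-1 *:
    \sum_(r < m.+1) 'C(m, r)%:R *:
      \sum_(t < n.+1) 'C(n, t)%:R *:
        ((x + y) ^+ Zexp m n r t * (x - y) ^+ Oexp m n r t).
Proof.
have nz : (2 ^+ (m + n) : rat) != 0 by rewrite expf_neq0.
apply: (scalerI nz); rewrite scalerA divff // scale1r.
have natE k (z : L) : k%:R *: z = k%:R * z by rewrite scaler_nat mulr_natl.
under eq_bigr do rewrite natE.
under [RHS]eq_bigr do [rewrite natE; under eq_bigr do rewrite natE].
by rewrite -natrX natE natrX product_SPC_character_sum.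
Qed.

Unset Implicit Arguments.

Theorem theorem10 (m n : nat) (hm : (2 <= m)%N) (hn : (2 <= n)%N) :
  hom_weight_enum (product_code (SPC m) (SPC n)) =
    (2 ^+ (m + n))^-1 *:
      \sum_(r < m.+1) 'C(m, r)%:R *:
        \sum_(t < n.+1) 'C(n, t)%:R *:
          (('X_0 + 'X_1) ^+ Zexp m n r t * ('X_0 - 'X_1) ^+ Oexp m n r t)
  /\
  weight_enum (product_code (SPC m) (SPC n)) =
    (2 ^+ (m + n))^-1 *:
      \sum_(r < m.+1) 'C(m, r)%:R *:
        \sum_(t < n.+1) 'C(n, t)%:R *:
          ((1 + 'X) ^+ Zexp m n r t * (1 - 'X) ^+ Oexp m n r t).
Proof.
split; first exact: product_SPC_enumerator.
(* This is the instance where [x] is 1 and [y] is ['X]; only the powers of 1 remain to be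
   removed. *)
rewrite -product_SPC_enumerator; apply: eq_bigr => w _.
by rewrite expr1n mul1r.
Qed.
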